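(* For all $\mu,\nu\in\mathcal T$, their greatest common lower node $$\mu\wedge\nu=\max\big((-\infty,\mu\,]\cap(-\infty,\nu\,]\big)\in\mathcal T$$ exists; that is, the set $\{\rho\in\mathcal T\mid\rho\le\mu\text{ and }\rho\le\nu\}$ has a maximum element.
   Context: $(K,v)$ is a valued field, $\Gamma=v(K^* )$, and $\Gamma\hookrightarrow\Lambda$ is a fixed extension of ordered abelian groups; $\Lambda\infty=\Lambda\cup\{\infty\}$. $\mathcal T=\mathcal T(\Lambda)$ is the set of all valuations $\mu\colon K[x]\to\Lambda\infty$ (that is, $\mu(1)=0$, $\mu(0)=\infty$, $\mu(ab)=\mu(a)+\mu(b)$, $\mu(a+b)\ge\min\{\mu(a),\mu(b)\}$; nontrivial support $\mu^{-1}(\infty)$ is allowed) whose restriction to $K$ is $v$, partially ordered by $\mu\le\nu\iff\mu(f)\le\nu(f)$ for all $f\in K[x]$. Write $(-\infty,\mu\,]=\{\rho\in\mathcal T\mid\rho\le\mu\}$; $\mathcal T$ is a tree in the sense that all these intervals are totally ordered. Elements of $\mathcal T$ are called nodes. *)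

(* Defs.v *)
From HB Require Import structures.
From mathcomp Require Import all_boot all_order all_algebra.

Set Implicit Arguments.
Unset Strict Implicit.
Unset Printing Implicit Defensive.

Import Order.TTheory GRing.Theory Num.Theory.

Local Open Scope ring_scope.

(* [porderZmodType] only juxtaposes a partial order and a group law.  Totality
   is an axiom of the mixin instead of a join with [Order.Total], because HB
   rejects that join as missing from the hierarchy above [realDomainType]. *)
HB.mixin Record POrderedZmodule_isOrderedAbGroup G
    of Num.POrderedZmodule G := {
  oag_le_total : total (<=%R : rel G);
  oag_lerD2r : forall z x y : G, x <= y -> x + z <= y + z
}.

#[short(type="orderedAbGroupType")]
HB.structure Definition OrderedAbGroup :=
  { G of Num.POrderedZmodule G & POrderedZmodule_isOrderedAbGroup G }.

Definition with_infty (G : Type) : Type := option G.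

Definition infty {G : Type} : with_infty G := None.

Definition fin {G : Type} (g : G) : with_infty G := Some g.

Notation "G ∞" := (with_infty G) (at level 2, format "G ∞") : type_scope.
Notation "∞" := infty : ring_scope.

Definition map_infty {G H : Type} (f : G -> H) (x : G∞) : H∞ :=
  if x is Some g then fin (f g) else ∞.

Section WithInfty.
Variable G : orderedAbGroupType.
Implicit Types x y z : G∞.

Definition addi x y : G∞ :=
  match x, y with
  | Some a, Some b => fin (a + b)
  | _, _ => ∞
  end.

Definition lei x y : bool :=
  match x, y with
  | _, None => true
  | None, Some _ => false
  | Some a, Some b => a <= b
  end.

HB.instance Definition _ := Choice.copy (with_infty G) (option G).

Fact addiA : associative addi.
Proof. by case=> [a|] [b|] [c|] //=; rewrite addrA. Qed.

Fact addiC : commutative addi.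
Proof. by case=> [a|] [b|] //=; rewrite addrC. Qed.

Fact add0i : left_id (fin 0) addi.
Proof. by case=> [a|] //=; rewrite add0r. Qed.

HB.instance Definition _ :=
  GRing.isNmodule.Build (with_infty G) addiA addiC add0i.

Fact lei_refl : reflexive lei.
Proof. by case=> [a|] //=. Qed.

Fact lei_anti : antisymmetric lei.
Proof. by case=> [a|] [b|] //= /le_anti ->. Qed.

Fact lei_trans : transitive lei.
Proof. by case=> [b|] [a|] [c|] //=; apply: le_trans. Qed.

Fact lei_total : total lei.
Proof. by case=> [a|] [b|] //=; apply: oag_le_total. Qed.

HB.instance Definition _ :=
  Order.Le_isPOrder.Build ring_display (with_infty G)
    lei_refl lei_anti lei_trans.

HB.instance Definition _ :=
  Order.POrder_isTotal.Build ring_display (with_infty G) lei_total.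

End WithInfty.

(* The support w^-1(∞) may be nonzero; when A is a field, the axioms force
   it to be {0}. *)
Record is_valuation (A : nzRingType) (G : orderedAbGroupType) (w : A -> G∞) :
    Prop := IsValuation {
  val1 : w 1 = 0;
  val0 : w 0 = ∞;
  valM : forall a b, w (a * b) = w a + w b;
  valD : forall a b, Num.min (w a) (w b) <= w (a + b)
}.

(* G = v(K^* ) for a valuation v : K -> G∞; the inclusion v(K^* ) ⊆ G, i.e.
   finiteness of v on K^*, already follows from the axioms since K is a field. *)
Definition is_value_group (K : fieldType) (G : orderedAbGroupType)
    (v : K -> G∞) : Prop :=
  forall g : G, exists2 a : K, a != 0 & v a = fin g.

Section Nodes.
Variables (K : fieldType) (Gamma Lambda : orderedAbGroupType).
Variables (v : K -> Gamma∞) (iota : Gamma -> Lambda).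

Record node := Node {
  node_fun :> {poly K} -> Lambda∞;
  node_valuation : is_valuation node_fun;
  node_restr : forall a : K, node_fun a%:P = map_infty iota (v a)
}.

Definition node_le (mu nu : node) : Prop :=
  forall f : {poly K}, mu f <= nu f.

(* The interval (-∞, mu]. *)
Definition lower_interval (mu : node) : node -> Prop :=
  fun rho => node_le rho mu.

End Nodes.

Definition is_maximum (T : Type) (le : T -> T -> Prop) (S : T -> Prop) (m : T) :
    Prop :=
  S m /\ forall x, S x -> le x m.

(* Main.v *)
Require Import Defs.
From HB Require Import structures.
From mathcomp Require Import all_boot all_order all_algebra.
From mathcomp Require Import zify.
From Stdlib Require Import Classical.
Import Order.TTheory GRing.Theory Num.Theory.
Local Open Scope ring_scope.

(** If [mu] and [nu] differ, choose [phi] of least degree among the polynomials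
    on which they differ, say with [mu phi < nu phi].  The meet is then the
    truncation of [mu] at [phi],
      [rho (sum_i a_i phi^i) = min_i (mu a_i + i * mu phi)], deg a_i < deg phi.

    Everything rests on one observation ([val_le_rem]): if [w1 <= w2] at [f] and
    [q], [w2 <= w1] at [r], [f = q * p + r] and [w1 p < w2 p], then
    [w1 f <= w1 r].  Otherwise [r] and [q * p] would cancel to first order for
    [w1], while [w2] raises the value of [q * p], hence that of [r] too.

    For [(mu, nu, phi)] it controls the remainder modulo [phi] of a product of
    two digits ([trunc_mul_small]), so that [rho] is supermultiplicative
    ([trunc_mul_ge]).  The reverse inequality ([trunc_mul_le]) comes from [nu]:
    if the minimum defining [rho] is attained at the digit of index 0 for both
    factors, then [rho] and [nu] agree on both, and [rho <= nu] on the product;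
    otherwise one factor [phi] can be split off.

    For a common lower bound [sigma], apply it to [(sigma, nu, psi)], where
    [psi] has least degree such that [sigma psi < nu psi]; one may take
    [psi = phi] unless deg psi < deg phi.  It shows that [sigma f] is at most
    the value predicted by the [psi]-expansion of [f], digit by digit, and there
    [sigma <= mu = rho] on the digits and [sigma psi <= rho psi]
    ([le_trunc]). *)

Set Implicit Arguments.
Unset Strict Implicit.

(** * Extended ordered groups *)

Section ExtendedGroup.
Variable G : orderedAbGroupType.
Implicit Types x y z : G∞.

Lemma le_infty x : x <= ∞.
Proof. by case: x. Qed.

Lemma addinfty x : x + ∞ = ∞.
Proof. by case: x. Qed.

Lemma leiD2r z x y : x <= y -> x + z <= y + z.
Proof.
by case: x y z => [a|] [b|] [c|] //=; apply: (@oag_lerD2r G c a b).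
Qed.

Lemma leiD x y z t : x <= y -> z <= t -> x + z <= y + t.
Proof.
move=> xy zt; apply: (le_trans (leiD2r z xy)).
by rewrite ![y + _]addrC; apply: leiD2r.
Qed.

Lemma ltiD2r z x y : z < ∞ -> x < y -> x + z < y + z.
Proof.
move=> zfin xy; rewrite lt_neqAle leiD2r ?ltW // andbT.
apply: contraTneq xy => E; suff -> : x = y by rewrite ltxx.
by case: z x y zfin E => [c|] [a|] [b|] // _ [/addIr ->].
Qed.

Lemma ltiD2l z x y : z < ∞ -> x < y -> z + x < z + y.
Proof. by rewrite ![z + _]addrC; apply: ltiD2r. Qed.

(** Strict monotonicity in the second summand, whether or not [z] is finite. *)
Lemma lt_le_addi c z z' x y :
  c < ∞ -> c <= z + x -> z <= z' -> x < y -> c < z' + y.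
Proof.
move=> c_fin cle zz' xy; apply: lt_le_trans (leiD2r y zz').
have [z_fin|] := ltP z (∞); first exact: le_lt_trans (ltiD2l z_fin xy).
by case: z {cle zz'} => // _; case: y xy.
Qed.

Lemma addii_eq0 x : x + x = 0 -> x = 0.
Proof.
case: x => [a|] // [aa0]; congr Some; apply/le_anti.
by case/orP: (oag_le_total a 0) => h; have := oag_lerD2r a _ _ h;
  rewrite aa0 add0r h => ->.
Qed.

Lemma minDl z x y : Num.min x y + z = Num.min (x + z) (y + z).
Proof.
case: (leP x y) => [/(leiD2r z)/min_idPl -> //|].
by move=> /ltW /(leiD2r z)/min_idPr ->.
Qed.

End ExtendedGroup.

(** * Valuations *)

Section Valuation.
Variables (A : nzRingType) (G : orderedAbGroupType) (w : A -> G∞).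
Hypothesis w_val : is_valuation w.

Lemma val_opp a : w (- a) = w a.
Proof.
have w1 : w (-1) = 0.
  by apply: addii_eq0; rewrite -(Defs.valM w_val) mulrNN mulr1 (Defs.val1 w_val).
by rewrite -mulN1r (Defs.valM w_val) w1 add0r.
Qed.

Lemma valD_le z a b : z <= w a -> z <= w b -> z <= w (a + b).
Proof.
by move=> za zb; apply: le_trans (Defs.valD w_val a b); rewrite le_min za.
Qed.

Lemma valD_lt z a b : z < w a -> z < w b -> z < w (a + b).
Proof.
by move=> za zb; apply: lt_le_trans (Defs.valD w_val a b); rewrite lt_min za.
Qed.

(** A summand of large value does not affect the value of a sum. *)
Lemma valD_lt_eq a b : w a < w b -> w (a + b) = w a.
Proof.
move=> ab; apply/le_anti/andP; split; last by apply: valD_le (ltW ab).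
rewrite leNgt; apply/negP => lt; suff: w a < w a by rewrite ltxx.
by rewrite -[in X in _ < X](addrK b a) valD_lt ?val_opp.
Qed.

End Valuation.

(** The inequality that drives the whole argument. *)
Lemma val_le_rem (A : nzRingType) (G : orderedAbGroupType) (w1 w2 : A -> G∞)
    (w1_val : is_valuation w1) (w2_val : is_valuation w2) (f p q r : A) :
  f = q * p + r -> w1 f <= w2 f -> w1 q <= w2 q -> w2 r <= w1 r ->
  w1 p < w2 p -> w1 f <= w1 r.
Proof.
move=> fE f12 q12 r21 p12; rewrite leNgt; apply/negP => rf.
suff: w1 r < w2 r by rewrite ltNge r21.
have qpE : q * p = f - r by rewrite fE addrK.
have qp_ge : w1 r <= w1 (q * p).
  by rewrite qpE; apply: (valD_le w1_val); rewrite ?(val_opp w1_val) // ltW.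
have qp_gt : w1 r < w2 (q * p).
  rewrite (Defs.valM w2_val); apply: lt_le_addi q12 p12.
    exact: lt_le_trans rf (le_infty _).
  by rewrite -(Defs.valM w1_val).
have -> : w2 r = w2 (f - q * p) by rewrite fE addrAC subrr add0r.
apply: (valD_lt w2_val); last by rewrite (val_opp w2_val).
exact: lt_le_trans rf f12.
Qed.

(** * Truncations *)

Lemma size_divp_lt (K : fieldType) (p f : {poly K}) :
  (1 < size p)%N -> f != 0 -> (size (f %/ p)%R < size f)%N.
Proof.
move=> p1 f0; rewrite size_divp -?size_poly_gt0 ?(ltn_trans _ p1) //.
by rewrite -subn1 ltn_subrL subn_gt0 p1 size_poly_gt0.
Qed.

(** Induction on the number of base-[p] digits. *)
Lemma divp_ind (K : fieldType) (p : {poly K}) (P : {poly K} -> Prop) :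
  (1 < size p)%N -> P 0 -> (forall f, P (f %/ p) -> P f) -> forall f, P f.
Proof.
move=> p1 P0 PS f; have [m] := ubnP (size f).
elim: m f => // m IHm f /ltnSE fm.
have [->|f0] := eqVneq f 0; first exact: P0.
by apply: PS; apply: IHm; apply: leq_trans (size_divp_lt p1 f0) fm.
Qed.

Lemma ex_min_size (K : fieldType) (P : {poly K} -> Prop) (f : {poly K}) :
  P f ->
  exists g, [/\ P g, (size g <= size f)%N &
                forall h : {poly K}, (size h < size g)%N -> ~ P h].
Proof.
have [m] := ubnP (size f); elim: m f => // m IHm f /ltnSE fm Pf.
have [[h [h_lt Ph]]|no_h] :=
  classic (exists h : {poly K}, (size h < size f)%N /\ P h).
  have [g [Pg gh g_min]] := IHm h (leq_trans h_lt fm) Ph.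
  by exists g; split=> //; apply: leq_trans gh (ltnW h_lt).
by exists f; split=> // h h_lt Ph; apply: no_h; exists h.
Qed.

(** The truncation of [w] at [p], i.e. the minimum of the values
    [w a_i + i * w p] over the base-[p] digits [a_i] of [f]; the recursion
    inspects the first [n] digits only. *)
Fixpoint trunc_rec (K : fieldType) (G : orderedAbGroupType)
    (w : {poly K} -> G∞) (p : {poly K}) (n : nat) (f : {poly K}) : G∞ :=
  if n is m.+1 then
    Num.min (w (f %% p)) (trunc_rec w p m (f %/ p) + w p)
  else ∞.

(** A polynomial has at most [size f] digits in base [p] when deg p > 0. *)
Definition trunc (K : fieldType) (G : orderedAbGroupType)
    (w : {poly K} -> G∞) (p f : {poly K}) : G∞ :=
  trunc_rec w p (size f) f.

Section Truncation.
Variables (K : fieldType) (G : orderedAbGroupType).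
Variables (mu nu : {poly K} -> G∞) (phi : {poly K}).
Implicit Types a b f g h : {poly K}.
Hypotheses (mu_val : is_valuation mu) (nu_val : is_valuation nu).
Hypothesis phi_gt1 : (1 < size phi)%N.
Hypothesis mu_nu : forall a, (size a < size phi)%N -> mu a = nu a.
Hypothesis phi_lt : mu phi < nu phi.

Local Notation rho := (trunc mu phi).

Let phi_neq0 : phi != 0.
Proof. by rewrite -size_poly_gt0 (ltn_trans _ phi_gt1). Qed.

Lemma trunc_rec0 n : trunc_rec mu phi n 0 = ∞.
Proof.
by elim: n => //= n IHn; rewrite mod0p div0p IHn (Defs.val0 mu_val) minxx.
Qed.

Lemma trunc0 : rho 0 = ∞.
Proof. exact: trunc_rec0. Qed.

Lemma trunc_rec_size n f : (size f <= n)%N -> trunc_rec mu phi n f = rho f.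
Proof.
rewrite /trunc; have [m] := ubnP (size f).
elim: m n f => // m IHm n f /ltnSE fm fn.
have [->|f0] := eqVneq f 0; first by rewrite !trunc_rec0.
have f_gt0 : (0 < size f)%N by rewrite size_poly_gt0.
have := size_divp_lt phi_gt1 f0.
rewrite -(prednK f_gt0) -(prednK (leq_trans f_gt0 fn)) ltnS /= => q_f.
have f_n : ((size f).-1 <= n.-1)%N by rewrite -!subn1 leq_sub2r.
have q_m : (size (f %/ phi)%R < m)%N.
  by apply: leq_trans fm; rewrite -(prednK f_gt0) ltnS.
by rewrite (IHm n.-1) ?(leq_trans q_f) // (IHm (size f).-1).
Qed.

Lemma truncE f : rho f = Num.min (mu (f %% phi)) (rho (f %/ phi) + mu phi).
Proof.
rewrite -(@trunc_rec_size (size f).+1) //=.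
by rewrite trunc_rec_size // leq_divp.
Qed.

Lemma trunc_small a : (size a < size phi)%N -> rho a = mu a.
Proof.
by move=> a_lt; rewrite truncE modp_small // divp_small // trunc0 /= minElt;
  case: (mu a).
Qed.

Lemma trunc_mulphi f : rho (f * phi) = rho f + mu phi.
Proof.
by rewrite truncE modp_mull mulpK // (Defs.val0 mu_val) min_r // le_infty.
Qed.

Lemma trunc_phi : rho phi = mu phi.
Proof.
have := trunc_mulphi 1; rewrite mul1r => ->.
by rewrite trunc_small ?size_poly1 // (Defs.val1 mu_val) add0r.
Qed.

Lemma truncD f g : Num.min (rho f) (rho g) <= rho (f + g).
Proof.
move: f g; apply: (divp_ind phi_gt1) => [|f IHf] g.
  by rewrite add0r ge_min lexx orbT.
rewrite (truncE (f + g)) modpD divpD le_min; apply/andP; split.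
  apply: le_trans (Defs.valD mu_val _ _).
  by rewrite (truncE f) (truncE g) le_min !ge_min lexx /= lexx !orbT.
apply: le_trans (leiD2r _ (IHf _)).
by rewrite minDl le_min (truncE f) (truncE g) !ge_min !lexx !orbT.
Qed.

Lemma truncD_le z f g : z <= rho f -> z <= rho g -> z <= rho (f + g).
Proof. by move=> zf zg; apply: le_trans (truncD f g); rewrite le_min zf. Qed.

Lemma trunc_le_mu f : rho f <= mu f.
Proof.
move: f; apply: (divp_ind phi_gt1) => [|f IHf].
  by rewrite (Defs.val0 mu_val) le_infty.
rewrite truncE [in mu f](divp_eq f phi) [in mu (_ + _)]addrC.
apply: le_trans (Defs.valD mu_val _ _).
by rewrite le_min !ge_min lexx /= (Defs.valM mu_val) (leiD2r _ IHf) orbT.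
Qed.

Lemma trunc_le_nu f : rho f <= nu f.
Proof.
move: f; apply: (divp_ind phi_gt1) => [|f IHf].
  by rewrite (Defs.val0 nu_val) le_infty.
rewrite truncE [in nu f](divp_eq f phi) [in nu (_ + _)]addrC.
apply: le_trans (Defs.valD nu_val _ _).
rewrite le_min !ge_min mu_nu ?ltn_modp // lexx /= (Defs.valM nu_val).
by rewrite (leiD IHf (ltW phi_lt)) orbT.
Qed.

(** Reducing a product of two digits modulo [phi] does not lower its value. *)
Lemma trunc_mul_small a b :
  (size a < size phi)%N -> (size b < size phi)%N ->
  mu a + mu b <= rho (a * b).
Proof.
move=> a_lt b_lt; rewrite -(Defs.valM mu_val).
set q := (a * b) %/ phi; set r := (a * b) %% phi.
have abE : a * b = q * phi + r by exact: divp_eq.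
have r_lt : (size r < size phi)%N by rewrite ltn_modp.
have q_lt : (size q < size phi)%N.
  rewrite size_divp // (leq_ltn_trans (leq_sub2r _ (size_polyMleq _ _))) //.
  have lt_k m n k : (m < k -> n < k -> (m + n).-1 - k.-1 < k)%N by lia.
  exact: lt_k.
have ab_r : mu (a * b) <= mu r.
  apply: (val_le_rem mu_val nu_val abE) => //.
  - by rewrite (Defs.valM mu_val) (Defs.valM nu_val) !mu_nu.
  - by rewrite mu_nu.
  - by rewrite mu_nu.
rewrite truncE -/q -/r le_min ab_r /= trunc_small // -(Defs.valM mu_val).
have -> : q * phi = a * b - r by rewrite abE addrK.
by apply: (valD_le mu_val); rewrite ?(val_opp mu_val).
Qed.

(** The product of a single digit with a polynomial is treated by induction on
    the digits of the latter; a general product by induction on those of [f]. *)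
Lemma trunc_mul_ge f g : rho f + rho g <= rho (f * g).
Proof.
have small a h : (size a < size phi)%N -> mu a + rho h <= rho (a * h).
  move=> a_lt; move: h; apply: (divp_ind phi_gt1) => [|h IHh].
    by rewrite mulr0 trunc0 addinfty.
  rewrite [in a * h](divp_eq h phi) mulrDr mulrA.
  rewrite [in rho (_ + _)]addrC; apply: truncD_le.
    apply: le_trans (@trunc_mul_small a (h %% phi) a_lt _); rewrite ?ltn_modp //.
    by apply: leiD; rewrite // truncE ge_min lexx.
  rewrite trunc_mulphi; apply: le_trans (leiD2r _ IHh); rewrite -addrA.
  by apply: leiD; rewrite // truncE ge_min lexx orbT.
move: f; apply: (divp_ind phi_gt1) => [|f IHf].
  by rewrite mul0r trunc0 le_infty.
rewrite [in f * g](divp_eq f phi) mulrDl.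
rewrite [in rho (_ + _)]addrC; apply: truncD_le.
  apply: le_trans (small _ _ _); rewrite ?ltn_modp //.
  by apply: leiD2r; rewrite truncE ge_min lexx.
rewrite mulrAC trunc_mulphi; apply: le_trans (leiD2r _ IHf).
by rewrite addrAC; apply: leiD2r; rewrite truncE ge_min lexx orbT.
Qed.

(** If the 0-th digit attains the minimum, then [nu] does not increase the
    value, because [nu] is larger than [rho] on the multiples of [phi]. *)
Lemma trunc_eq_nu f : mu (f %% phi) <= rho (f %/ phi) + mu phi ->
  rho f = nu f.
Proof.
move=> a0_min; apply/le_anti; rewrite trunc_le_nu /=.
have rho_f : rho f = nu (f %% phi).
  by rewrite truncE min_l // mu_nu // ltn_modp.
have [a0_fin|] := ltP (nu (f %% phi)) (∞); last first.
  by rewrite rho_f; apply: le_trans (le_infty _).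
rewrite [in nu f](divp_eq f phi) addrC (valD_lt_eq nu_val) ?rho_f //.
rewrite (Defs.valM nu_val); apply: lt_le_addi a0_fin _ (trunc_le_nu _) phi_lt.
by rewrite -mu_nu ?ltn_modp.
Qed.

(** Splitting off one factor [phi] when the 0-th digit does not attain the
    minimum: the part of [f * g] coming from that digit is negligible. *)
Lemma trunc_mul_le_step f g :
  rho (f %/ phi) + mu phi < mu (f %% phi) ->
  rho (f %/ phi * g) <= rho (f %/ phi) + rho g ->
  rho (f * g) <= rho f + rho g.
Proof.
set q := f %/ phi; set a := f %% phi => q_lt IH.
have [g_fin|] := ltP (rho g) (∞); last first.
  by case: (rho g) => // _; rewrite addinfty le_infty.
have rho_f : rho f = rho q + mu phi by rewrite truncE min_r // ltW.
rewrite leNgt; apply/negP => fg_gt.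
suff: rho f + rho g < rho (q * g * phi).
  by rewrite trunc_mulphi rho_f addrAC ltNge leiD2r.
have -> : q * g * phi = f * g + (- a) * g.
  by rewrite [in f * g](divp_eq f phi) mulrDl mulNr addrK mulrAC.
apply: lt_le_trans (truncD _ _); rewrite lt_min fg_gt /=.
apply: lt_le_trans (trunc_mul_ge _ _); apply: ltiD2r => //.
by rewrite (@trunc_small (- a)) ?size_polyN ?ltn_modp // (val_opp mu_val) rho_f.
Qed.

Lemma trunc_mul_le f g : rho (f * g) <= rho f + rho g.
Proof.
have [m] := ubnP (size f + size g)%N; elim: m f g => // m IHm f g /ltnSE fg_m.
have q_lt h : rho (h %/ phi) + mu phi < mu (h %% phi) ->
    (size (h %/ phi)%R < size h)%N.
  move=> h_lt; apply: size_divp_lt => //.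
  by apply: contraTneq h_lt => ->; rewrite div0p trunc0 -leNgt le_infty.
have [f_min|f_lt] := leP (mu (f %% phi)) (rho (f %/ phi) + mu phi); last first.
  apply: trunc_mul_le_step => //; apply: IHm.
  by apply: leq_trans fg_m; rewrite ltn_add2r q_lt.
have [g_min|g_lt] := leP (mu (g %% phi)) (rho (g %/ phi) + mu phi); last first.
  rewrite mulrC addrC; apply: trunc_mul_le_step => //; apply: IHm.
  by apply: leq_trans fg_m; rewrite addnC ltn_add2l q_lt.
by rewrite (trunc_eq_nu f_min) (trunc_eq_nu g_min) -(Defs.valM nu_val) trunc_le_nu.
Qed.

Lemma trunc_valuation : is_valuation rho.
Proof.
split; [|exact: trunc0| |exact: truncD].
  by rewrite trunc_small ?size_poly1 // (Defs.val1 mu_val).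
by move=> f g; apply/le_anti; rewrite trunc_mul_le trunc_mul_ge.
Qed.

(** * Maximality of the truncation *)

Section LowerBound.
Variable sigma : {poly K} -> G∞.
Hypotheses (sigma_val : is_valuation sigma).
Hypothesis sigma_polyC : forall c, sigma c%:P = mu c%:P.
Hypotheses (sigma_mu : forall f, sigma f <= mu f).
Hypotheses (sigma_nu : forall f, sigma f <= nu f).

(** The polynomial [psi] of the argument: of least degree with
    [sigma psi < nu psi], and equal to [phi] if that degree is deg phi. *)
Lemma ex_first_increase : exists psi, [/\ sigma psi < nu psi,
  sigma psi <= rho psi, (size psi <= size phi)%N &
  forall a, (size a < size psi)%N -> nu a <= sigma a].
Proof.
pose P f := sigma f < nu f.
have [[a [a_lt Pa]]|no_a] := classic (exists a, (size a < size phi)%N /\ P a).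
  have [psi [Ppsi psi_a psi_min]] := ex_min_size (P := P) Pa.
  have psi_lt := leq_ltn_trans psi_a a_lt.
  exists psi; split; rewrite ?trunc_small ?(ltnW psi_lt) //.
  by move=> b /psi_min/negP; rewrite /P -leNgt.
exists phi; split; rewrite ?trunc_phi //; first exact: le_lt_trans phi_lt.
by move=> a a_lt; rewrite leNgt; apply/negP => Pa; apply: no_a; exists a.
Qed.

(** Each digit of the [psi]-expansion, and [psi] itself, has at most the same
    value under [sigma] as under [rho]; by [val_le_rem], [sigma] gives [f] no more
    than the minimum over its [psi]-expansion. *)
Lemma le_trunc f : sigma f <= rho f.
Proof.
have [psi [psi_incr psi_rho psi_phi psi_min]] := ex_first_increase.
(* The valuations agree on constants, so [psi] is not constant. *)
have psi_gt1 : (1 < size psi)%N.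
  rewrite ltnNge; apply: contraTN psi_incr => psi1.
  rewrite -leNgt -mu_nu ?(leq_ltn_trans psi1) //.
  by rewrite (size1_polyC psi1) sigma_polyC.
move: f; apply: (divp_ind psi_gt1) => [|f IHf].
  by rewrite trunc0 le_infty.
set q := f %/ psi in IHf; set b := f %% psi.
have fE : f = q * psi + b by exact: divp_eq.
have b_lt : (size b < size psi)%N by rewrite ltn_modp -size_poly_gt0 ltnW.
have f_b : sigma f <= sigma b.
  by apply: (val_le_rem sigma_val nu_val fE) => //; apply: psi_min.
have f_q : sigma f <= sigma (q * psi).
  have -> : q * psi = f - b by rewrite fE addrK.
  by apply: (valD_le sigma_val); rewrite ?(val_opp sigma_val).
rewrite [in rho f]fE; apply: truncD_le.
  apply: le_trans f_q _; rewrite (Defs.valM sigma_val).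
  exact: le_trans (leiD IHf psi_rho) (trunc_mul_ge _ _).
by rewrite trunc_small ?(leq_trans b_lt) // (le_trans f_b).
Qed.

End LowerBound.
End Truncation.

Unset Implicit Arguments.
Set Strict Implicit.

Theorem proposition5p2
  (K : fieldType) (Gamma Lambda : orderedAbGroupType)
  (v : K -> Gamma∞) (v_val : is_valuation v) (v_Gamma : is_value_group v)
  (iota : {additive Gamma -> Lambda}) (iota_mono : {mono iota : x y / x <= y})
  (mu nu : node v iota) :
  exists rho : node v iota,
    is_maximum (@node_le K Gamma Lambda v iota)
      (fun sigma => lower_interval mu sigma /\ lower_interval nu sigma) rho.
Proof.
have [[f mu_nu]|no_f] := classic (exists f, mu f <> nu f); last first.
  have mu_nu f : mu f = nu f by apply: NNPP => ne; apply: no_f; exists f.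
  by exists mu; split=> [|sigma []] //; split=> f; rewrite ?mu_nu.
have [phi [phi_ne _ phi_min]] := ex_min_size (P := fun h => mu h <> nu h) mu_nu.
wlog phi_lt : mu nu {f mu_nu} phi_ne phi_min / mu phi < nu phi.
  move=> wlg; case: (ltgtP (mu phi) (nu phi)) => [lt|gt|/phi_ne //].
    exact: wlg.
  have [||//|rho [[rho_nu rho_mu] rho_max]] := wlg nu mu.
  - exact/nesym.
  - by move=> h /phi_min hmin /nesym.
  by exists rho; split=> // sigma [? ?]; apply: rho_max.
have mu_val := node_valuation mu; have nu_val := node_valuation nu.
have mu_nu (a : {poly K}) : (size a < size phi)%N -> mu a = nu a.
  by move=> /phi_min/NNPP.
have phi_gt1 : (1 < size phi)%N.
  rewrite ltnNge; apply/negP => phi1; apply: phi_ne.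
  by rewrite (size1_polyC phi1) !node_restr.
have rho_restr c : trunc mu phi c%:P = map_infty iota (v c).
  rewrite -(node_restr mu) trunc_small //.
  exact: leq_ltn_trans (size_polyC_leq1 c) phi_gt1.
exists (Node (trunc_valuation mu_val nu_val phi_gt1 mu_nu phi_lt) rho_restr).
split=> [|sigma [sigma_mu sigma_nu] f] /=.
  by split=> f /=; [apply: trunc_le_mu | apply: trunc_le_nu].
apply: (le_trunc mu_val nu_val phi_gt1 mu_nu phi_lt) => //.
  exact: node_valuation.
by move=> c; rewrite !node_restr.
Qed.
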